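(* Let $A\in\mathbb{R}^{n\times n}$, $B\in\mathbb{R}^{n\times m}$, $Q\in\mathbb{R}^{n\times n}$, $S\in\mathbb{R}^{n\times m}$, $R\in\mathbb{R}^{m\times m}$ be such that $\Pi=\begin{bmatrix}Q&S\\S^\top&R\end{bmatrix}=\Pi^\top\ge 0$, and let $\Sigma=(A,B;\Pi)$. Let $A_0=A-BR^\dagger S^\top$ and $Q_0=Q-SR^\dagger S^\top$. Assume that $R$ is singular, that $A_0$ is non-singular, and that $A_0^{-1}B\ker R\neq\{0\}$. Let $\eta=\dim(A_0^{-1}B\ker R)$ and let $V=[\,V_1\;\;V_2\,]\in\mathbb{R}^{n\times n}$ be an orthogonal matrix with $\operatorname{im}V_2=A_0^{-1}B\ker R$. Let $A_V=V^\top A_0V$, $B_V=V^\top B$, $Q_V=V^\top Q_0V$, $A_1=V_1^\top A_0V_1$, $B_1=V_1^\top B$, $R_1=R+B^\top Q_0B$; let $Q_1\in\mathbb{R}^{(n-\eta)\times(n-\eta)}$ be the upper-left block of $A_V^\top Q_VA_V$ and $S_1\in\mathbb{R}^{(n-\eta)\times m}$ the matrix formed by the first $n-\eta$ rows of $A_V^\top Q_VB_V$. Then the set of solutions of CGDARE($\Sigma$) is exactly the set of matrices of the form $$X=V\begin{bmatrix}\Delta_1&0\\0&0\end{bmatrix}V^\top+Q_0,$$ where $\Delta_1\in\mathbb{R}^{(n-\eta)\times(n-\eta)}$ ranges over the symmetric solutions of $$\Delta_1=A_1^\top\Delta_1A_1-(A_1^\top\Delta_1B_1+S_1)(R_1+B_1^\top\Delta_1B_1)^\dagger(B_1^\top\Delta_1A_1+S_1^\top)+Q_1,$$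 $$\ker(R_1+B_1^\top\Delta_1B_1)\subseteq\ker(S_1+A_1^\top\Delta_1B_1).$$
   Context: $M^\dagger$ denotes the Moore-Penrose pseudo-inverse of a real matrix $M$. For $\Sigma=(A,B;\Pi)$ with $\Pi=\begin{bmatrix}Q&S\\S^\top&R\end{bmatrix}=\Pi^\top\ge0$ (positive semidefinite), CGDARE($\Sigma$) (the constrained generalized discrete-time algebraic Riccati equation) is the pair of relations in the unknown $X$ $$X=A^\top XA-(A^\top XB+S)(R+B^\top XB)^\dagger(S^\top+B^\top XA)+Q,$$ $$\ker(R+B^\top XB)\subseteq\ker(A^\top XB+S).$$ Only real symmetric solutions are considered: ''solution'' always means real symmetric solution. $A_0^{-1}B\ker R$ denotes the subspace $\{A_0^{-1}Bw: w\in\ker R\}$ of $\mathbb{R}^n$. *)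

(* Defs.v *)
From mathcomp Require Import all_boot all_order all_algebra.
From mathcomp Require Import reals.

Set Implicit Arguments.
Unset Strict Implicit.
Unset Printing Implicit Defensive.

Import Order.TTheory GRing.Theory Num.Theory.
Local Open Scope ring_scope.

Section MoorePenrose.
Variable K : realType.

(* The four Penrose equations; transposition is the adjoint over the reals. *)
Definition is_mpinv m n (M : 'M[K]_(m, n)) (P : 'M[K]_(n, m)) : Prop :=
  [/\ M *m P *m M = M, P *m M *m P = P,
      (M *m P)^T = M *m P & (P *m M)^T = P *m M].

(* Full-rank factorization formula: if M = C F with C of full column rank and
   F of full row rank, then the pseudo-inverse is
   F^T (F F^T)^-1 (C^T C)^-1 C^T.  Lemmas mpinvP and mpinv_uniq show that this
   is the unique solution of the Penrose equations; mathcomp's pinvmx is only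
   a one-sided partial inverse. *)
Definition mpinv m n (M : 'M[K]_(m, n)) : 'M[K]_(n, m) :=
  let C := col_base M in let F := row_base M in
  F^T *m invmx (F *m F^T) *m (invmx (C^T *m C) *m C^T).

Lemma mulmx_tr_eq0 m n (M : 'M[K]_(m, n)) : M *m M^T = 0 -> M = 0.
Proof.
move=> MMT0; apply/matrixP=> i j; rewrite mxE.
have /eqP := congr1 (fun N : 'M_m => N i i) MMT0.
rewrite !mxE psumr_eq0 => [|k _]; last by rewrite mxE -expr2 sqr_ge0.
by move=> /allP/(_ j (mem_index_enum _)); rewrite mxE -expr2 sqrf_eq0 => /eqP.
Qed.

Lemma row_free_gram_unit m n (F : 'M[K]_(m, n)) :
  row_free F -> F *m F^T \in unitmx.
Proof.
move=> freeF; rewrite -row_free_unit -kermx_eq0.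
have kF0 : kermx (F *m F^T) *m F = 0.
  apply: mulmx_tr_eq0.
  by rewrite trmx_mul mulmxA -(mulmxA _ F) mulmx_ker mul0mx.
by apply/eqP/(row_free_inj freeF); rewrite kF0 mul0mx.
Qed.

Lemma mpinvP m n (M : 'M[K]_(m, n)) : is_mpinv M (mpinv M).
Proof.
have MCF : M = col_base M *m row_base M by rewrite mulmx_base.
have uF : row_base M *m (row_base M)^T \in unitmx.
  exact/row_free_gram_unit/row_base_free.
have uC : (col_base M)^T *m col_base M \in unitmx.
  rewrite -{2}[col_base M]trmxK; apply: row_free_gram_unit.
  by rewrite /row_free mxrank_tr; apply: col_base_full.
rewrite /mpinv /=; move: (\rank M) (col_base M) (row_base M) MCF uF uC => r C F MCF uF uC.
set P := F^T *m _ *m _.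
have MP : M *m P = C *m invmx (C^T *m C) *m C^T.
  rewrite MCF /P -!mulmxA; congr (C *m _).
  by rewrite (mulmxA F) mulmxA mulmxV // mul1mx.
have PM : P *m M = F^T *m invmx (F *m F^T) *m F.
  rewrite MCF /P -!mulmxA; congr (F^T *m (_ *m _)).
  by rewrite (mulmxA C^T) mulmxA mulVmx // mul1mx.
split.
- by rewrite MP MCF mulmxA -(mulmxA _ C^T) mulmxKV.
- by rewrite PM /P !mulmxA -(mulmxA (F^T *m _) F) mulmxKV.
- by rewrite MP !trmx_mul trmxK trmx_inv trmx_mul trmxK mulmxA.
- by rewrite PM !trmx_mul trmxK trmx_inv trmx_mul trmxK mulmxA.
Qed.

Lemma mpinv_uniq m n (M : 'M[K]_(m, n)) (P : 'M[K]_(n, m)) :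
  is_mpinv M P -> P = mpinv M.
Proof.
case: (mpinvP M); move: (mpinv M) => N N1 N2 N3 N4 [P1 P2 P3 P4].
have MPN : M *m P = M *m N.
  have : (M *m N *m (M *m P))^T = (M *m P)^T by rewrite mulmxA N1.
  by rewrite trmx_mul P3 N3 mulmxA P1.
have PMN : P *m M = N *m M.
  have : (P *m M *m (N *m M))^T = (P *m M)^T.
    by rewrite -mulmxA (mulmxA M) N1.
  by rewrite trmx_mul P4 N4 -mulmxA (mulmxA M) P1.
by rewrite -P2 -mulmxA MPN mulmxA PMN N2.
Qed.

End MoorePenrose.

Section Riccati.
Variable K : realType.

Definition psdmx n (M : 'M[K]_n) : Prop :=
  M^T = M /\ forall x : 'cV[K]_n, 0 <= (x^T *m M *m x) 0 0.

(* The row and column sizes are allowed to differ syntactically: for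
   V = row_mx V1 V2 with V1 : 'M_(n, n - k) and V2 : 'M_(n, k), V has type
   'M_(n, n - k + k), which is square only up to a provable equality. *)
Definition orthogonal_mx m n (V : 'M[K]_(m, n)) : Prop :=
  V^T *m V = 1%:M /\ V *m V^T = 1%:M.

(* Kernel, range and direct image for the action on column vectors. *)
Definition mxker m n (M : 'M[K]_(m, n)) : {vspace 'cV[K]_n} :=
  lker (linfun (mulmx M)).

Definition mxrange m n (M : 'M[K]_(m, n)) : {vspace 'cV[K]_m} :=
  limg (linfun (mulmx M)).

Definition mximage m n (M : 'M[K]_(m, n)) (U : {vspace 'cV[K]_n}) :
  {vspace 'cV[K]_m} := (linfun (mulmx M) @: U)%VS.

(* Symmetry of X and positive semidefiniteness of [Q S; S^T R] are not part of
   the predicate. *)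
Definition cgdare n m (A : 'M[K]_n) (B : 'M[K]_(n, m)) (Q : 'M[K]_n)
    (S : 'M[K]_(n, m)) (R : 'M[K]_m) (X : 'M[K]_n) : Prop :=
  X = A^T *m X *m A
      - (A^T *m X *m B + S) *m mpinv (R + B^T *m X *m B)
          *m (S^T + B^T *m X *m A)
      + Q
  /\ (mxker (R + B^T *m X *m B)
        <= mxker (A^T *m X *m B + S))%VS.

End Riccati.

(* Main.v *)
(* Since Pi >= 0 gives S = S R^+ R, X solves CGDARE(A, B, Q, S, R) iff it
   solves the equation with data (A0, B, Q0, 0, R), that is,
   X - Q0 = A0^T (X - X B R_X^+ B^T X) A0 with R_X = R + B^T X B and
   ker R_X included in ker (X B). For w in ker R one has B^T X B w = R_X w, so
   the right-hand side kills A0^-1 B w. Hence X - Q0 is symmetric and vanishes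
   on A0^-1 B ker R = im V2, and only its compression to im V1 matters. The
   same computation shows that the V2 blocks of the equation and of the kernel
   inclusion hold automatically, which gives the converse. *)
Require Import Defs.
From mathcomp Require Import all_boot all_order all_algebra.
From mathcomp Require Import reals ring.

Import Order.TTheory GRing.Theory Num.Theory.
Local Open Scope ring_scope.

(** * Pseudo-inverses and kernel inclusions as matrix identities *)

Section Kernels.
Variable K : realType.

Lemma mem_mxker m n (M : 'M[K]_(m, n)) (w : 'cV_n) :
  (w \in mxker M) = (M *m w == 0).
Proof. by rewrite memv_ker lfunE. Qed.

(** The columns of [1 - mpinv M *m M] lie in the kernel of [M], because [M *m mpinv M *m M = M], so
    [N] must kill them. This makes the kernel conditions usable in matrix computations. *)
Lemma mxker_subP m n p (M : 'M[K]_(m, n)) (N : 'M[K]_(p, n)) :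
  (mxker M <= mxker N)%VS <-> N *m mpinv M *m M = N.
Proof.
have [MPM _ _ _] := mpinvP M; split=> [/subvP sMN | NPM].
  apply/esym/eqP; rewrite -subr_eq0 -{1}[N]mulmx1 -mulmxA -mulmxBr.
  apply/eqP/matrixP=> i j; rewrite [RHS]mxE.
  have : col j (1%:M - mpinv M *m M) \in mxker M.
    by rewrite mem_mxker colE mulmxA mulmxBr mulmx1 mulmxA MPM subrr mul0mx.
  move/sMN; rewrite mem_mxker colE mulmxA -colE => /eqP/colP/(_ i).
  by rewrite !mxE.
apply/subvP=> w; rewrite !mem_mxker => /eqP Mw0.
by rewrite -NPM -mulmxA Mw0 mulmx0.
Qed.

Lemma mpinv_sym n (M : 'M[K]_n) : M^T = M -> (mpinv M)^T = mpinv M.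
Proof.
move=> symM; apply: mpinv_uniq; have [P1 P2 P3 P4] := mpinvP M.
have trMP P : M *m P^T = (P *m M)^T by rewrite trmx_mul symM.
have trPM P : P^T *m M = (M *m P)^T by rewrite trmx_mul symM.
split; rewrite ?trMP ?trPM ?trmxK //; first by rewrite mulmxA P1.
by rewrite -trmx_mul mulmxA P2.
Qed.

(** A preimage in ker R is chosen for each column of [M]; these are the columns of [W]. Applied to
    [V2], it will give A0 V2 = B W with R W = 0. *)
Lemma sub_mximage_mxker m n p q (M : 'M[K]_(m, p)) (N : 'M[K]_(m, n))
    (R : 'M[K]_(q, n)) :
  (mxrange M <= mximage N (mxker R))%VS ->
  exists2 W : 'M[K]_(n, p), R *m W = 0 & M = N *m W.
Proof.
move=> /subvP sMN.
have /fin_all_exists[w wP] (j : 'I_p) :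
    exists w : 'cV[K]_n, R *m w = 0 /\ col j M = N *m w.
  have : col j M \in mxrange M.
    by apply/memv_imgP; exists (delta_mx j 0); rewrite ?memvf // lfunE /= colE.
  move/sMN=> /memv_imgP[w]; rewrite mem_mxker lfunE => /eqP Rw0 ->.
  by exists w.
pose W : 'M[K]_(n, p) := \matrix_(i, j) w j i 0.
have colW j : col j W = w j by apply/colP=> i; rewrite !mxE.
have col_mulW k (L : 'M[K]_(k, n)) j : col j (L *m W) = L *m w j.
  by rewrite colE -mulmxA -colE colW.
by exists W; apply/matrixP=> i j; have [Rw0 defM] := wP j;
  [have := col_mulW _ R j | have := col_mulW _ N j];
  rewrite ?Rw0 -?defM => /colP/(_ i); rewrite !mxE.
Qed.

(** For w in ker R and y = S w, the form at (y, t w) is y^T Q y + 2 t y^T y. It is affine in t and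
    nonnegative for every t, so its slope vanishes and y = 0. *)
Lemma psd_block_ker n m (Q : 'M[K]_n) (S : 'M[K]_(n, m)) (R : 'M[K]_m) :
  psdmx (block_mx Q S S^T R) -> (mxker R <= mxker S)%VS.
Proof.
move=> [_ psd]; apply/subvP=> w; rewrite !mem_mxker => /eqP Rw0.
set y := S *m w; set s := (y^T *m y) 0 0; set q := (y^T *m Q *m y) 0 0.
have form t : 0 <= q + t * s *+ 2.
  have := psd (col_mx y (t *: w)).
  have Syw : w^T *m S^T *m y = y^T *m y by rewrite -trmx_mul.
  rewrite tr_col_mx mul_row_block mul_row_col !linearZ /=.
  rewrite -!scalemxAl !mulmxDl -!scalemxAl Syw -[_ *m R *m w]mulmxA Rw0.
  rewrite -[_ *m S *m w]mulmxA mulmx0 -/y /q /s.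
  move: (y^T *m Q *m y) (y^T *m y) => a b.
  by rewrite !mxE mulr0 addr0 -addrA -mulr2n.
have [s0 | sN0] := eqVneq s 0.
  rewrite -trmx_eq0; apply/eqP/mulmx_tr_eq0; rewrite trmxK.
  by apply/matrixP=> i j; rewrite !ord1 [RHS]mxE.
(* At this t the form takes the value -1. *)
have := form (- (q + 1) / (s *+ 2)).
rewrite -mulrnAr mulrVK ?unitfE ?mulrn_eq0 //.
by rewrite opprD addrA subrr sub0r oppr_ge0 ler10.
Qed.

End Kernels.

(** * Feedback invariance and compression of the Riccati equation *)

Section Riccati.
Variable K : realType.

(** Invariance under the feedback [T^T]: since B^T X B = R_X - R, the cross term Y = A^T X B becomes
    Y + T R_X, and T R_X already vanishes on ker R_X. With T = S R^+ this removes S from the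
    equation. *)
Lemma cgdare_feedback n m (A : 'M[K]_n) (B T : 'M[K]_(n, m)) (Q : 'M[K]_n)
    (R : 'M[K]_m) (X : 'M[K]_n) :
  R^T = R -> X^T = X ->
  cgdare (A + B *m T^T) B (Q + T *m R *m T^T) (T *m R) R X
    <-> cgdare A B Q 0 R X.
Proof.
move=> symR symX; rewrite /cgdare trmx0 addr0 add0r.
have [RX defRX] : exists RX, RX = R + B^T *m X *m B by eexists.
have [Y defY] : exists Y, Y = A^T *m X *m B by eexists.
rewrite -defRX -defY.
have symRX : RX^T = RX.
  by rewrite defRX linearD /= !trmx_mul trmxK symR symX mulmxA.
have trY : B^T *m X *m A = Y^T.
  by rewrite defY !trmx_mul trmxK symX mulmxA.
have defBXB : B^T *m X *m B = RX - R by rewrite defRX addrC addKr.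
have [RPR _ _ _] := mpinvP RX.
have symP := mpinv_sym _ _ _ symRX.
have kerP p (N : 'M_(p, m)) := mxker_subP _ _ _ _ RX N.
(* Abstracted because mulmxA would otherwise match inside mpinv. *)
move: (mpinv RX) RPR symP kerP => P RPR symP kerP.
have TRPR : T *m RX *m P *m RX = T *m RX.
  by rewrite -!mulmxA (mulmxA RX) RPR.
have -> : (A + B *m T^T)^T *m X *m B + T *m R = Y + T *m RX.
  rewrite linearD /= trmx_mul trmxK !mulmxDl -defY -addrA; congr (_ + _).
  by rewrite -2!mulmxA [B^T *m _]mulmxA defBXB mulmxBr subrK.
have -> : (T *m R)^T + B^T *m X *m (A + B *m T^T) = Y^T + RX *m T^T.
  rewrite mulmxDr trY trmx_mul symR mulmxA defBXB mulmxBl.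
  by rewrite addrCA [_ + (_ - _)]addrC subrK.
have -> : (mxker RX <= mxker (Y + T *m RX))%VS = (mxker RX <= mxker Y)%VS.
  apply/idP/idP => /kerP H; apply/kerP.
    by move: H; rewrite !mulmxDl TRPR; apply: addIr.
  by rewrite !mulmxDl H TRPR.
(* The right-hand sides agree only under the kernel inclusion, which is available in both directions
   of the equivalence. *)
suff eqRHS : (mxker RX <= mxker Y)%VS ->
    (A + B *m T^T)^T *m X *m (A + B *m T^T)
      - (Y + T *m RX) *m P *m (Y^T + RX *m T^T) + (Q + T *m R *m T^T)
    = A^T *m X *m A - Y *m P *m Y^T + Q.
  by rewrite trY; split=> -[XE kerY]; split=> //; rewrite ?eqRHS // -eqRHS.
move=> /kerP kerY.
have kerYt : RX *m P *m Y^T = Y^T.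
  by have := congr1 trmx kerY; rewrite !trmx_mul symP symRX mulmxA.
have -> : (A + B *m T^T)^T *m X *m (A + B *m T^T)
    = A^T *m X *m A + Y *m T^T + (T *m Y^T + (T *m RX *m T^T - T *m R *m T^T)).
  rewrite [(_ + _)^T]linearD /= trmx_mul trmxK mulmxDl mulmxDl !mulmxDr.
  by rewrite -mulmxBl -mulmxBr -defBXB -trY defY !mulmxA.
have -> : (Y + T *m RX) *m P *m (Y^T + RX *m T^T)
    = Y *m P *m Y^T + Y *m T^T + (T *m Y^T + T *m RX *m T^T).
  rewrite !mulmxDl !mulmxDr !mulmxA kerY TRPR; congr (_ + (_ + _)).
  by rewrite -!mulmxA (mulmxA RX) kerYt.
move: (A^T *m X *m A) (Y *m T^T) (T *m Y^T) (T *m RX *m T^T) (T *m R *m T^T).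
move: (Y *m P *m Y^T) => f a b c d e.
apply/matrixP=> i j; rewrite !mxE; ring.
Qed.

(** The hypotheses on [W] give Y^T V2 = B^T X B W = R_X W, where Y = A^T X B. This settles the V2
    part of the kernel inclusion and makes the right-hand side minus [Q] vanish on im V2. *)
Lemma cgdare_compress n m p q (A : 'M[K]_n) (B : 'M[K]_(n, m)) (Q : 'M[K]_n)
    (R : 'M[K]_m) (V1 : 'M[K]_(n, p)) (V2 : 'M[K]_(n, q)) (W : 'M[K]_(m, q))
    (X : 'M[K]_n) :
  R^T = R -> X^T = X -> V1 *m V1^T + V2 *m V2^T = 1%:M ->
  A *m V2 = B *m W -> R *m W = 0 ->
  let RX := R + B^T *m X *m B in
  let Y := V1^T *m A^T *m X *m B in
  cgdare A B Q 0 R X <->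
  X = V1 *m (V1^T *m A^T *m X *m A *m V1 - Y *m mpinv RX *m Y^T) *m V1^T + Q
  /\ (mxker RX <= mxker Y)%VS.
Proof.
move=> symR symX V1V2 AV2 RW0; rewrite /cgdare /= trmx0 addr0 add0r.
have [RX defRX] : exists RX, RX = R + B^T *m X *m B by eexists.
have [Y defY] : exists Y, Y = A^T *m X *m B by eexists.
have -> : V1^T *m A^T *m X *m B = V1^T *m Y by rewrite defY !mulmxA.
rewrite -defRX -defY.
have symRX : RX^T = RX.
  by rewrite defRX linearD /= !trmx_mul trmxK symR symX mulmxA.
have trY : B^T *m X *m A = Y^T.
  by rewrite defY !trmx_mul trmxK symX mulmxA.
have RXW : B^T *m X *m B *m W = RX *m W.
  by rewrite defRX [RHS]mulmxDl RW0 add0r.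
have YtV2 : Y^T *m V2 = RX *m W by rewrite -trY -mulmxA AV2 mulmxA.
have V2Y : V2^T *m Y = W^T *m RX.
  by rewrite -[RX]symRX -trmx_mul -YtV2 trmx_mul trmxK.
have [RPR _ _ _] := mpinvP RX.
have symP := mpinv_sym _ _ _ symRX.
have kerP k (N : 'M_(k, m)) := mxker_subP _ _ _ _ RX N.
move: (mpinv RX) RPR symP kerP => P RPR symP kerP.
have -> : (mxker RX <= mxker (V1^T *m Y))%VS = (mxker RX <= mxker Y)%VS.
  apply/idP/idP => /kerP H; apply/kerP.
    (* Y = V1 V1^T Y + V2 V2^T Y, and V2^T Y = W^T R_X vanishes on ker R_X. *)
    rewrite -[Y]mul1mx -V1V2 [(_ + _) *m Y]mulmxDl -!(mulmxA _ _ Y) V2Y.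
    rewrite !mulmxDl -!(mulmxA V1) H; congr (_ + _).
    by rewrite -!mulmxA (mulmxA RX) RPR.
  by rewrite -!(mulmxA V1^T) H.
have [E defE] : exists E, E = A^T *m X *m A - Y *m P *m Y^T by eexists.
have -> : V1^T *m A^T *m X *m A *m V1 - V1^T *m Y *m P *m (V1^T *m Y)^T
    = V1^T *m E *m V1.
  by rewrite defE mulmxBr mulmxBl trmx_mul trmxK !mulmxA.
rewrite trY -defE.
suff EP : (mxker RX <= mxker Y)%VS -> E = V1 *m (V1^T *m E *m V1) *m V1^T.
  by split=> -[XE kerY]; split=> //; move: XE; rewrite -EP.
move=> /kerP kerY.
(* E V2 = Y W - Y P R_X W, and the kernel inclusion says Y P R_X = Y. *)
have EV2 : E *m V2 = 0.
  rewrite defE mulmxBl -!mulmxA AV2 YtV2 !mulmxA -defY kerY.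
  by rewrite subrr.
have V2E : V2^T *m E = 0.
  have symE : E^T = E.
    rewrite defE [(_ - _)^T]linearB /= !trmx_mul !trmxK symX symP.
    by rewrite !mulmxA.
  by rewrite -symE -trmx_mul EV2 trmx0.
have EV1 : E = E *m V1 *m V1^T.
  by rewrite -{1}[E]mulmx1 -V1V2 mulmxDr !mulmxA EV2 mul0mx addr0.
have V1E : E = V1 *m (V1^T *m E).
  by rewrite -{1}[E]mul1mx -V1V2 mulmxDl -!mulmxA V2E mulmx0 addr0.
by rewrite {1}V1E {1}EV1 !mulmxA.
Qed.

End Riccati.

Theorem corollary2 (K : realType) (n m : nat)
    (A : 'M[K]_n) (B : 'M[K]_(n, m)) (Q : 'M[K]_n) (S : 'M[K]_(n, m))
    (R : 'M[K]_m) :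
  psdmx (block_mx Q S S^T R) ->
  let A0 := A - B *m mpinv R *m S^T in
  let Q0 := Q - S *m mpinv R *m S^T in
  R \notin unitmx ->
  A0 \in unitmx ->
  let U := mximage (invmx A0 *m B) (mxker R) in
  U != 0%VS ->
  let eta := \dim U in
  forall (V1 : 'M[K]_(n, n - eta)) (V2 : 'M[K]_(n, eta)),
  let V := row_mx V1 V2 in
  orthogonal_mx V ->
  mxrange V2 = U ->
  let AV := V^T *m A0 *m V in
  let BV := V^T *m B in
  let QV := V^T *m Q0 *m V in
  let A1 := V1^T *m A0 *m V1 in
  let B1 := V1^T *m B in
  let R1 := R + B^T *m Q0 *m B in
  let Q1 := ulsubmx (AV^T *m QV *m AV) in
  let S1 := usubmx (AV^T *m QV *m BV) in
  forall X : 'M[K]_n,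
  (X^T = X /\ cgdare A B Q S R X) <->
  (exists Delta1 : 'M[K]_(n - eta),
    [/\ Delta1^T = Delta1,
        Delta1 = A1^T *m Delta1 *m A1
          - (A1^T *m Delta1 *m B1 + S1)
              *m mpinv (R1 + B1^T *m Delta1 *m B1)
              *m (B1^T *m Delta1 *m A1 + S1^T)
          + Q1,
        (mxker (R1 + B1^T *m Delta1 *m B1)
           <= mxker (S1 + A1^T *m Delta1 *m B1))%VS
      & X = V *m block_mx Delta1 0 0 0 *m V^T + Q0]).
Proof.
move=> psd A0 Q0 _ unitA0 U _ eta V1 V2 V [VtV VVt] imV2.
move=> AV BV QV A1 B1 R1 Q1 S1 X.
have /mxker_subP kerS := psd_block_ker _ _ _ _ _ _ psd.
have [symQ symR] : Q^T = Q /\ R^T = R.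
  by case: psd => + _; rewrite tr_block_mx trmxK => /eq_block_mx[-> _ _ ->].
have symRd := mpinv_sym _ _ _ symR.
(* With this T one has T R = S, A0 + B T^T = A and Q0 + T R T^T = Q. *)
pose T := S *m mpinv R.
have trT : T^T = mpinv R *m S^T by rewrite trmx_mul symRd.
have TRT : T *m R *m T^T = S *m mpinv R *m S^T by rewrite kerS trT mulmxA.
have symQ0 : Q0^T = Q0.
  by rewrite /Q0 [(_ - _)^T]linearB /= symQ 2!trmx_mul trmxK symRd mulmxA.
have [W RW0 defV2] : exists2 W : 'M[K]_(m, eta), R *m W = 0
    & V2 = invmx A0 *m B *m W.
  by apply: sub_mximage_mxker; rewrite imV2.
have AV2 : A0 *m V2 = B *m W by rewrite defV2 !mulmxA mulmxV // mul1mx.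
have V1V2 : V1 *m V1^T + V2 *m V2^T = 1%:M.
  by rewrite -VVt /V tr_row_mx mul_row_col.
have V1V1 : V1^T *m V1 = 1%:M.
  move: VtV; rewrite /V tr_row_mx mul_col_row scalar_mx_block.
  by move=> /eq_block_mx[].
(* V V^T = 1 cancels the inner factors, and the upper rows of V^T are V1^T. *)
have defS1 : S1 = V1^T *m A0^T *m Q0 *m B.
  rewrite /S1 /AV /QV /BV !trmx_mul trmxK -!mulmxA !(mulmxA V) VVt !mul1mx.
  by rewrite tr_row_mx mul_col_mx col_mxKu.
have defQ1 : Q1 = V1^T *m A0^T *m Q0 *m A0 *m V1.
  rewrite /Q1 /AV /QV !trmx_mul trmxK -!mulmxA !(mulmxA V) VVt !mul1mx.
  by rewrite tr_row_mx mul_col_mx /ulsubmx col_mxKu !mul_mx_row row_mxKl.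
have feedback : X^T = X -> cgdare A B Q S R X <-> cgdare A0 B Q0 0 R X.
  move=> symX; have := cgdare_feedback _ _ _ A0 B T Q0 R X symR symX.
  by rewrite TRT kerS trT mulmxA !subrK.
have /= compress (symX : X^T = X) :=
  cgdare_compress _ _ _ _ _ A0 B Q0 R V1 V2 W X symR symX V1V2 AV2 RW0.
have embedD D : V *m block_mx D 0 0 0 *m V^T = V1 *m D *m V1^T.
  rewrite /V mul_row_block tr_row_mx mul_row_col !mulmx0 !addr0.
  by rewrite mul0mx addr0.
have trA1 : A1^T = V1^T *m A0^T *m V1 by rewrite !trmx_mul trmxK mulmxA.
have trB1 : B1^T = B^T *m V1 by rewrite trmx_mul trmxK.
(* For X = V1 D V1^T + Q0, the Q0 part of each coefficient of the compressed equation supplies the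
   constant term: it completes R to [R1] here, and gives [S1] and [Q1] below. *)
have RXE D : R + B^T *m (V1 *m D *m V1^T + Q0) *m B = R1 + B1^T *m D *m B1.
  rewrite mulmxDr mulmxDl trB1 /B1 /R1 !mulmxA -addrA.
  by rewrite [_ + B^T *m Q0 *m B]addrC.
have YE D : V1^T *m A0^T *m (V1 *m D *m V1^T + Q0) *m B
    = A1^T *m D *m B1 + S1.
  by rewrite mulmxDr mulmxDl trA1 /B1 defS1 !mulmxA.
have AXAE D : V1^T *m A0^T *m (V1 *m D *m V1^T + Q0) *m A0 *m V1
    = A1^T *m D *m A1 + Q1.
  by rewrite mulmxDr !mulmxDl trA1 defQ1 /A1 !mulmxA.
have YtE D : D^T = D -> (A1^T *m D *m B1 + S1)^T = B1^T *m D *m A1 + S1^T.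
  move=> symD; rewrite [(_ + _)^T]linearD /= trmx_mul.
  by rewrite [(_ *m D)^T]trmx_mul trmxK symD mulmxA.
split=> [[symX /(feedback symX) /(compress symX)[]] | [D [symD DE kerD XE]]].
  (* Delta1 is the middle factor of the compressed equation; by V1^T V1 = 1 it equals V1^T (X - Q0)
     V1, hence is symmetric. *)
  set D := (X in V1 *m X *m _) => XE kerX.
  have symD : D^T = D.
    have -> : D = V1^T *m (X - Q0) *m V1.
      by rewrite XE addrK -!mulmxA V1V1 !mulmxA V1V1 mul1mx mulmx1.
    rewrite 2!trmx_mul trmxK [(_ - _)^T]linearB /= symX symQ0.
    by rewrite mulmxA.
  exists D; split=> //.
  - by rewrite {1}/D XE RXE YE AXAE YtE // addrAC.
  - by rewrite [S1 + _]addrC -RXE -YE -XE.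
  - by rewrite embedD.
rewrite embedD in XE.
(* Both equivalences assume X symmetric, so this has to come first. *)
have symX : X^T = X.
  rewrite XE linearD /= symQ0 2!trmx_mul trmxK symD.
  by rewrite mulmxA.
split=> //; apply/(feedback symX)/(compress symX); split.
  by rewrite [LHS]XE XE AXAE RXE YE YtE // addrAC -DE.
by rewrite XE RXE YE [_ + S1]addrC.
Qed.
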